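(* Let $H$ be an $r$-tree (for some positive integer $r$) and let $\eta>0$. Then there exist $\rho=\rho(\eta,H)>0$ and $n_0$ such that for every $d$ and every $(\rho,d)$-dense graph $G$ with $|V(G)|\ge n_0$, \[ t_H(G)\ge d^{|E(H)|}-\eta. \]
   Context: All graphs are finite and simple. For graphs $H,G$, $\mathrm{Hom}(H,G)$ is the set of graph homomorphisms (adjacency-preserving vertex maps) from $H$ to $G$, and the homomorphism density is $t_H(G)=|\mathrm{Hom}(H,G)|/|V(G)|^{|V(H)|}$. A graph $G$ is $(\rho,d)$-dense if every vertex subset $X\subseteq V(G)$ with $|X|\ge\rho|V(G)|$ spans at least $\frac d2|X|^2$ edges. A tree decomposition of a graph $H$ is a pair $(\mathcal F,\mathcal T)$ where $\mathcal F$ is a family of subsets of $V(H)$ and $\mathcal T$ is a tree with vertex set $\mathcal F$ such that (1) $\bigcup_{X\in\mathcal F}X=V(H)$; (2) every edge of $H$ is contained in some $X\in\mathcal F$; (3) for $X,Y,Z\in\mathcal F$, $X\cap Y\subseteq Z$ whenever $Z$ lies on the path from $X$ to $Y$ in $\mathcal T$. An $r$-tree is a graph $H$ admitting a tree decomposition $(\mathcal F,\mathcal T)$ in which every induced subgraph $H[X]$, $X\in\mathcal F$, is isomorphic to the complete graph $K_{r+1}$.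
   Formalization: The density parameter d is taken to be a nonnegative real; for negative d every graph is (ρ,d)-dense and the bound fails, e.g. for d = -2, H a path with two edges and small η. *)

(* Defs.v *)
From HB Require Import structures.
From mathcomp Require Import all_boot all_order all_algebra reals.

Set Implicit Arguments.
Unset Strict Implicit.
Unset Printing Implicit Defensive.

Import Order.TTheory GRing.Theory Num.Theory.
Local Open Scope ring_scope.

Record sgraph (V : finType) := SGraph {
  adj :> rel V;
  adj_sym : symmetric adj;
  adj_irr : irreflexive adj
}.

Definition edges (V : finType) (G : sgraph V) : {set {set V}} :=
  [set [set x; y] | x in V, y in V & G x y].

Definition edges_in (V : finType) (G : sgraph V) (X : {set V}) : {set {set V}} :=
  [set e in edges G | e \subset X].

Definition complete_rel (n : nat) : rel 'I_n := fun i j => i != j.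

Lemma complete_sym n : symmetric (@complete_rel n).
Proof. by move=> i j; rewrite /complete_rel eq_sym. Qed.

Lemma complete_irr n : irreflexive (@complete_rel n).
Proof. by move=> i; rewrite /complete_rel eqxx. Qed.

Definition complete (n : nat) : sgraph 'I_n :=
  SGraph (@complete_sym n) (@complete_irr n).

Definition induced_rel (V : finType) (G : sgraph V) (X : {set V}) :
  rel {x : V | x \in X} := fun u v => G (val u) (val v).

Lemma induced_sym (V : finType) (G : sgraph V) (X : {set V}) :
  symmetric (@induced_rel V G X).
Proof. by move=> u v; apply: adj_sym. Qed.

Lemma induced_irr (V : finType) (G : sgraph V) (X : {set V}) :
  irreflexive (@induced_rel V G X).
Proof. by move=> u; apply: adj_irr. Qed.

Definition induced (V : finType) (G : sgraph V) (X : {set V}) :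
  sgraph {x : V | x \in X} :=
  SGraph (@induced_sym V G X) (@induced_irr V G X).

Definition isomorphic (V W : finType) (G : sgraph V) (H : sgraph W) : Prop :=
  exists2 f : V -> W, bijective f & forall x y, H (f x) (f y) = G x y.

Definition homs (V W : finType) (H : sgraph V) (G : sgraph W) :
  {set {ffun V -> W}} :=
  [set f : {ffun V -> W} | [forall x, forall y, H x y ==> G (f x) (f y)]].

Definition hom_density (R : realType) (V W : finType)
    (H : sgraph V) (G : sgraph W) : R :=
  #|homs H G|%:R / #|W|%:R ^+ #|V|.

Definition dense (R : realType) (rho d : R) (W : finType) (G : sgraph W) : Prop :=
  forall X : {set W}, rho * #|W|%:R <= #|X|%:R ->
    d / 2 * #|X|%:R ^+ 2 <= #|edges_in G X|%:R.

Definition is_tree (V : finType) (T : sgraph V) : Prop :=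
  [/\ (0 < #|V|)%N,
      forall x y, connect T x y &
      forall c : seq V, ucycle T c -> (size c <= 2)%N].

(* In a tree [x :: p] below is the unique simple path from [x] to [y]. *)
Definition on_path (V : finType) (T : sgraph V) (x y z : V) : Prop :=
  exists p : seq V,
    [/\ path T x p, last x p = y, uniq (x :: p) & z \in x :: p].

Definition tree_decomposition (V : finType) (H : sgraph V)
    (F : {set {set V}}) (T : sgraph {X : {set V} | X \in F}) : Prop :=
  [/\ is_tree T,
      cover F = [set: V],
      forall e, e \in edges H -> exists2 X, X \in F & e \subset X &
      forall X Y Z, on_path T X Y Z -> val X :&: val Y \subset val Z].

Definition r_tree (r : nat) (V : finType) (H : sgraph V) : Prop :=
  exists (F : {set {set V}}) (T : sgraph {X : {set V} | X \in F}),
    tree_decomposition H T /\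
    forall X, X \in F -> isomorphic (induced H X) (complete r.+1).

(* Main.v *)
(** Sample a random map V -> W by gluing uniformly random (r+1)-cliques of G on
    the bags, conditionally independently given the separators S (each bag's
    intersection with the earlier ones).  Hoelder's inequality under this measure
    gives t_H * prod_S t_{K_|S|} >= t_{K_(r+1)}^(number of bags).  Cauchy-Schwarz
    and local density give t_{K_(k+2)} t_{K_k} >= d (t_{K_(k+1)}^2 - rho^2 t_{K_k}^2),
    hence, for theta < 1 and rho small, t_{K_(k+1)} >= (theta d)^k t_{K_k}.  The
    exponents of theta d sum to |E(H)|. *)
Require Import Defs.
From mathcomp Require Import all_boot all_order all_algebra reals.
From mathcomp Require Import ring lra.

Set Implicit Arguments.
Unset Strict Implicit.
Unset Printing Implicit Defensive.

Import Order.TTheory GRing.Theory Num.Theory.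
Local Open Scope ring_scope.

(** * Hoelder's inequality for finitely many factors, via AM-GM *)

Section Holder.
Variables (R : realFieldType) (T : finType) (I : eqType).
Implicit Types (w : T -> R) (g : I -> T -> R) (s : seq I).

Lemma AGM_seq s (x : I -> R) :
  (forall i, 0 <= x i) ->
  \prod_(i <- s) x i <= (\sum_(i <- s) x i / (size s)%:R) ^+ size s.
Proof.
move=> x0; rewrite -mulr_suml 2!(big_tnth _ _ s).
have := leif_AGM (A := 'I_(size s)) (E := fun i => x (tnth (in_tuple s) i)).
by rewrite card_ord => /(_ (fun i _ => x0 _)) [].
Qed.

(** Let [a i] be the mean of [g i]. If the product of the means were below 1, then on the support of
    [w] the product of the ratios [g i f / a i] would exceed 1, so by AM-GM their sum would exceed
    [size s]; yet this sum has mean exactly [size s]. *)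
Lemma holder_prod_ge1 w g s :
    (forall f, 0 <= w f) -> \sum_f w f = 1 -> (forall i f, 0 <= g i f) ->
    (forall f, w f != 0 -> 1 <= \prod_(i <- s) g i f) ->
  1 <= \prod_(i <- s) \sum_f w f * g i f.
Proof.
move=> w0 w1 g0 hg; pose a i := \sum_f w f * g i f.
have a0 i : 0 <= a i by apply: sumr_ge0 => f _; rewrite mulr_ge0.
have [f0 wf0] : exists f, w f != 0.
  case: (pickP (fun f => w f != 0)) => [f wf|w_eq0]; first by exists f.
  move: w1; rewrite big1 => [/esym/eqP|f _]; first by rewrite oner_eq0.
  by apply/eqP; have := w_eq0 f; case: eqP.
(* A zero mean would make [g i] vanish at [f0], where the product is at least 1. *)
have apos i : i \in s -> 0 < a i.
  move=> is_; rewrite lt0r a0 andbT; apply/eqP => /psumr_eq0P ai0.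
  have := hg f0 wf0; rewrite (big_rem i) //=.
  have /eqP : w f0 * g i f0 = 0 by apply: ai0 => // f _; rewrite mulr_ge0.
  by rewrite mulf_eq0 (negPf wf0) /= => /eqP ->; rewrite mul0r ler10.
rewrite leNgt; apply/negP => prod_lt1.
have s0 : (0 < size s)%N by case: (s) prod_lt1 => //; rewrite big_nil ltxx.
have sR0 : 0 < (size s)%:R :> R by rewrite ltr0n.
have prod_gt0 : 0 < \prod_(i <- s) a i.
  by rewrite big_seq; apply: prodr_gt0 => i; apply: apos.
have big f : w f != 0 -> (size s)%:R < \sum_(i <- s) g i f / a i.
  move=> wf; rewrite -[ltLHS]mul1r -ltr_pdivlMr // mulr_suml.
  rewrite ltNge; apply/negP => le1.
  have : \prod_(i <- s) (g i f / a i) <= 1.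
    apply: le_trans (AGM_seq _ _) _ => [i|]; first by rewrite divr_ge0.
    apply: exprn_ile1 => //; apply: sumr_ge0 => i _.
    by rewrite !divr_ge0.
  rewrite big_split /= prodfV ler_pdivrMr // mul1r leNgt.
  by rewrite (lt_le_trans prod_lt1) // hg.
have : \sum_f w f * (size s)%:R < \sum_f w f * \sum_(i <- s) g i f / a i.
  rewrite (bigD1 f0) // [ltRHS](bigD1 f0) //=; apply: ltr_leD.
    by rewrite ltr_pM2l ?big // lt0r wf0 w0.
  apply: ler_sum => f _; have [->|wf] := eqVneq (w f) 0; first by rewrite !mul0r.
  by rewrite ler_wpM2l // ltW // big.
rewrite -mulr_suml w1 mul1r; under eq_bigr do rewrite mulr_sumr.
rewrite exchange_big /= (eq_big_seq (fun=> 1)) => [|i /apos ai].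
  by rewrite big_const_seq count_predT iter_addr_0 ltxx.
under eq_bigr do rewrite mulrA.
by rewrite -mulr_suml divff // gt_eqF.
Qed.
End Holder.

(** * Normalised counts of clique extensions *)

Section CliqueExtensions.
Variables (R : realFieldType) (W : finType) (G : sgraph W).
Implicit Types (A : {set W}) (phi psi : {set W} -> R).
Local Notation n := (#|W|%:R : R).

Definition common_nbrs A : {set W} := [set v | [forall a in A, G a v]].

(* The normalised sum of [phi (A :|: B)] over all ordered [k]-cliques [B] of
   common neighbours of [A]. *)
Fixpoint ext k phi A : R :=
  if k is k'.+1 then (\sum_(v in common_nbrs A) ext k' phi (v |: A)) / n
  else phi A.

Definition extdens k A : R := ext k (fun=> 1) A.

Definition clique_dens k : R := extdens k set0.

Lemma ext_ext j k phi A : ext j (ext k phi) A = ext (j + k) phi A.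
Proof.
by elim: j A => //= j IH A; congr (_ / _); apply: eq_bigr => v _; apply: IH.
Qed.

(** Integrates a pointwise affine bound over all clique extensions; the constant [b] picks up the
    total mass [extdens k A]. *)
Lemma ext_le_affine k phi psi (a b : R) A :
  (forall B, a * phi B + b <= psi B) ->
  a * ext k phi A + b * extdens k A <= ext k psi A.
Proof.
move=> le; elim: k A => [|k IH] A; first by rewrite /extdens /= mulr1.
rewrite /extdens /= !mulrA -mulrDl ler_wpM2r ?invr_ge0 ?ler0n //.
by rewrite !mulr_sumr -big_split /=; apply: ler_sum => v _; apply: IH.
Qed.

Lemma extdens_ge0 k A : 0 <= extdens k A.
Proof.
elim: k A => [|k IH] A; first exact: ler01.
by rewrite /extdens /= divr_ge0 ?ler0n // sumr_ge0 // => v _; apply: IH.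
Qed.

Lemma extdens1 A : extdens 1 A = #|common_nbrs A|%:R / n.
Proof. by rewrite /extdens /= sumr_const. Qed.

Lemma common_nbrsU v A :
  common_nbrs (v |: A) = [set u in common_nbrs A | G v u].
Proof.
apply/setP => u; rewrite !inE; apply/forall_inP/andP => [h|[/forall_inP h vu] a].
  by split; [apply/forall_inP => a aA|]; apply: h; rewrite !inE ?aA ?orbT ?eqxx.
by rewrite !inE => /predU1P [->|/h].
Qed.

(** Group the ordered adjacent pairs by their underlying edge: by irreflexivity each edge comes from
    two distinct pairs. *)
Lemma edges_in_le (X : {set W}) :
  2 * #|edges_in G X|%:R <= \sum_(u in X) \sum_(v in X) (G u v)%:R :> R.
Proof.
pose P := [pred p : W * W | [&& p.1 \in X, p.2 \in X & G p.1 p.2]].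
have -> : \sum_(u in X) \sum_(v in X) (G u v)%:R = \sum_(p | P p) 1 :> R.
  rewrite pair_big /= [RHS]big_mkcond [LHS]big_mkcond /=.
  by apply: eq_bigr => -[u v] _ /=; case: (u \in X); case: (v \in X); case: (G u v).
rewrite (partition_big (fun p => [set p.1; p.2]) (mem (edges_in G X))) /=.
  rewrite mulrC -sumr_const mulr_suml.
  apply: ler_sum => e; rewrite inE => /andP [/imset2P [x y _]].
  rewrite inE => /andP [_ xy] -> /subsetP sX.
  have xX : x \in X by apply: sX; rewrite !inE eqxx.
  have yX : y \in X by apply: sX; rewrite !inE eqxx orbT.
  have xNy : x != y by apply: contraTneq xy => ->; rewrite adj_irr.
  rewrite (bigD1 (x, y)) /=; last by rewrite xX yX xy eqxx.
  rewrite (bigD1 (y, x)) /=; last first.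
    by rewrite xX yX adj_sym xy setUC eqxx /= xpair_eqE eq_sym (negPf xNy).
  by rewrite addrA mul1r -[leLHS]addr0 lerD // sumr_ge0.
move=> [u v] /and3P [/= uX vX uv]; rewrite inE; apply/andP; split.
  by apply/imset2P; exists u v; rewrite ?inE.
by apply/subsetP => z; rewrite !inE => /orP [] /eqP ->.
Qed.

Lemma extdens2 A :
  extdens 2 A = (\sum_(u in common_nbrs A) \sum_(v in common_nbrs A) (G u v)%:R) / n ^+ 2.
Proof.
rewrite /extdens /= expr2 invfM mulrA -mulr_suml; congr (_ / _ / _).
apply: eq_bigr => u _; rewrite common_nbrsU.
rewrite [LHS]big_mkcond [RHS]big_mkcond /=; apply: eq_bigr => v _.
by rewrite inE; case: (v \in _); case: (G u v).
Qed.

End CliqueExtensions.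

(** * Clique densities in a locally dense graph *)

Section LocallyDense.
Variables (R : realType) (W : finType) (G : sgraph W) (rho d : R).
Hypotheses (d0 : 0 <= d) (rho0 : 0 <= rho) (W0 : (0 < #|W|)%N).
Hypothesis dG : dense rho d G.
Local Notation n := (#|W|%:R : R).
Local Notation t := (clique_dens R G).

Lemma dense_le1 : rho <= 1 -> d <= 1.
Proof.
move=> rho1; have n0 : 0 < n by rewrite ltr0n.
have := dG (X := setT); rewrite cardsT => /(_ _) h0.
  have {}h0 := h0 (ler_piMl (ltW n0) rho1).
have := edges_in_le R G setT.
have : \sum_(u in [set: W]) \sum_(v in [set: W]) (G u v)%:R <= n ^+ 2 :> R.
  have -> : n ^+ 2 = \sum_(u in [set: W]) \sum_(v in [set: W]) 1.
    by rewrite !sumr_const cardsT expr2 mulr_natr.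
  by do 2!apply: ler_sum => ? _; rewrite lern1 leq_b1.
move=> h1 h2.
have : d * n ^+ 2 <= 1 * n ^+ 2 by lra.
by rewrite ler_pM2r // exprn_gt0.
Qed.

(** Local density applies to the common neighbourhood of [A] when that is large; otherwise the left
    side is nonpositive. The [rho ^+ 2] term lets one bound serve every [A]. *)
Lemma extdens2_ge A : d * (extdens R G 1 A ^+ 2 - rho ^+ 2) <= extdens R G 2 A.
Proof.
have n0 : 0 < n by rewrite ltr0n.
rewrite extdens1 extdens2; set N := common_nbrs G A.
rewrite ler_pdivlMr ?exprn_gt0 // -mulrA mulrBl -exprMn divfK ?gt_eqF //.
have [big|small] := leP (rho * n) #|N|%:R.
  apply: le_trans (edges_in_le R G N); have := dG big.
  have : 0 <= d * (rho ^+ 2 * n ^+ 2) by rewrite !mulr_ge0 ?exprn_ge0 // ltW.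
  by move=> h1 h2; lra.
apply: (@le_trans _ _ 0); last by do 2!apply: sumr_ge0 => ? _.
rewrite mulr_ge0_le0 // subr_le0 -exprMn lerXn2r ?nnegrE ?ler0n ?(ltW small) //.
by rewrite mulr_ge0 // ltW.
Qed.

(** Cauchy-Schwarz in linearised form: the tangent bound [y ^+ 2 >= 2 * lam * y - lam ^+ 2] is
    applied to [y = extdens R G 1 B] and summed over the ordered [k]-cliques [B]. *)
Lemma clique_dens_step k (lam : R) :
  d * (2 * lam * t k.+1 - (lam ^+ 2 + rho ^+ 2) * t k) <= t k.+2.
Proof.
have /(_ k set0) := @ext_le_affine R W G _ (extdens R G 1) (extdens R G 2)
  (d * (2 * lam)) (- (d * (lam ^+ 2 + rho ^+ 2))) _.
have -> : ext G k (extdens R G 1) set0 = t k.+1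
  by rewrite -[k.+1]addn1; exact: (ext_ext G k 1 (fun=> 1 : R)).
have -> : ext G k (extdens R G 2) set0 = t k.+2
  by rewrite -[k.+2]addn2; exact: (ext_ext G k 2 (fun=> 1 : R)).
rewrite -/(t k) => H.
apply: le_trans (H _) => [|B]; first by rewrite le_eqVlt; apply/orP; left; apply/eqP; ring.
apply: le_trans (extdens2_ge B).
have : 0 <= d * (extdens R G 1 B - lam) ^+ 2 by rewrite mulr_ge0 // sqr_ge0.
by lra.
Qed.

(** Positivity is carried along so that quotients of consecutive densities make sense. Each quotient
    used is at least [(theta * d) ^+ r], so [rho ^+ 2] costs at most a fraction [1 - theta] of its
    square. *)
Lemma clique_dens_ratio (theta : R) (r k : nat) :
    0 < theta -> theta <= 1 -> 0 < d -> d <= 1 ->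
    rho ^+ 2 <= (1 - theta) * (theta * d) ^+ r.*2 -> (k <= r)%N ->
  0 < t k /\ (theta * d) ^+ k * t k <= t k.+1.
Proof.
move=> th0 th1 dpos d1 hrho; set e := theta * d.
have e0 : 0 < e by rewrite mulr_gt0.
have e1 : e <= 1 by rewrite mulr_ile1 // ltW.
elim: k => [_|k IH kr].
  rewrite expr0 mul1r; have -> : t 0 = 1 by [].
  have -> : t 1 = 1; last by [].
  rewrite /clique_dens extdens1.
  have -> : common_nbrs G set0 = setT.
    by apply/setP => v; rewrite !inE; apply/forall_inP => a; rewrite inE.
  by rewrite cardsT divff // pnatr_eq0 -lt0n.
have [t0 le] := IH (ltnW kr).
have t1 : 0 < t k.+1 by apply: lt_le_trans le; rewrite mulr_gt0 ?exprn_gt0.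
(* This [lam] maximises the lower bound of [clique_dens_step]. *)
split=> //; set lam := t k.+1 / t k.
have tlam : t k.+1 = lam * t k by rewrite /lam divfK // gt_eqF.
have lamge : e ^+ k <= lam by rewrite /lam ler_pdivlMr.
have lam0 : 0 < lam by rewrite divr_gt0.
have rholam : rho ^+ 2 <= (1 - theta) * lam ^+ 2.
  apply: le_trans hrho _; rewrite ler_wpM2l ?subr_ge0 //.
  apply: le_trans (_ : (e ^+ k) ^+ 2 <= _).
    by rewrite -exprM muln2 ler_wiXn2l ?(ltW e0) ?e1 ?leq_double ?(ltnW kr).
  by rewrite lerXn2r ?nnegrE ?exprn_ge0 // ltW.
apply: le_trans (clique_dens_step k lam); rewrite tlam.
have -> : 2 * lam * (lam * t k) - (lam ^+ 2 + rho ^+ 2) * t k =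
  (lam ^+ 2 - rho ^+ 2) * t k by ring.
have h : theta * lam ^+ 2 <= lam ^+ 2 - rho ^+ 2 by lra.
apply: le_trans (_ : d * (theta * lam ^+ 2 * t k) <= _); last first.
  by rewrite ler_wpM2l // ler_wpM2r // ltW.
have -> : d * (theta * lam ^+ 2 * t k) = e * lam * (lam * t k) by rewrite /e; ring.
rewrite exprS; apply: ler_wpM2r; first by rewrite mulr_ge0 // ltW.
by apply: ler_wpM2l; first exact: ltW.
Qed.

(** The one-step ratios telescope; their exponents [s, ..., r] sum to the difference of the
    binomials. *)
Lemma clique_dens_ratio_le (theta : R) (r s : nat) :
    0 < theta -> theta <= 1 -> 0 < d -> d <= 1 ->
    rho ^+ 2 <= (1 - theta) * (theta * d) ^+ r.*2 -> (s <= r.+1)%N ->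
  (theta * d) ^+ ('C(r.+1, 2) - 'C(s, 2)) * t s <= t r.+1.
Proof.
move=> th0 th1 dpos d1 hrho sr.
suff H k : (s + k <= r.+1)%N ->
    (theta * d) ^+ ('C(s + k, 2) - 'C(s, 2)) * t s <= t (s + k).
  by have := H (r.+1 - s)%N; rewrite subnKC //; apply.
elim: k => [|k IH]; first by rewrite addn0 subnn mul1r.
rewrite addnS ltnS => kr.
have [_] := clique_dens_ratio th0 th1 dpos d1 hrho kr.
apply: le_trans; rewrite binS bin1 [('C(_, _) + _)%N]addnC -addnBA ?leq_bin2l ?leq_addr //.
rewrite exprD -mulrA ler_wpM2l ?exprn_ge0 ?mulr_ge0 ?(ltW th0) //.
by rewrite IH // ltnW.
Qed.

End LocallyDense.

(** * Averages over uniformly random maps *)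

Section RandomMaps.
Variables (R : realFieldType) (V W : finType) (G : sgraph W).
Hypothesis W0 : (0 < #|W|)%N.
Implicit Types (f : {ffun V -> W}) (F A : {ffun V -> W} -> R) (S X : {set V}).
Local Notation n := (#|W|%:R : R).
Local Notation t := (clique_dens R G).

Definition avg F : R := (\sum_f F f) / n ^+ #|V|.

Definition upd f x v : {ffun V -> W} := [ffun y => if y == x then v else f y].

Definition indep_of (D : {set V}) F :=
  forall f x v, x \in D -> F (upd f x v) = F f.

Definition is_clique S f : bool :=
  [forall x in S, forall y in S, (x != y) ==> G (f x) (f y)].

Lemma n_gt0 : 0 < n. Proof. by rewrite ltr0n. Qed.

Lemma avg_ge0 F : (forall f, 0 <= F f) -> 0 <= avg F.
Proof. by move=> F0; rewrite divr_ge0 ?exprn_ge0 ?ler0n ?sumr_ge0. Qed.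

Lemma avg_le F F' : (forall f, F f <= F' f) -> avg F <= avg F'.
Proof.
by move=> le; rewrite ler_wpM2r ?invr_ge0 ?exprn_ge0 ?ler0n //; apply: ler_sum.
Qed.

Lemma eq_avg F F' : (forall f, F f = F' f) -> avg F = avg F'.
Proof. by move=> e; congr (_ / _); apply: eq_bigr. Qed.

Lemma avg1 : avg (fun=> 1) = 1.
Proof.
by rewrite /avg sumr_const card_ffun natrX divff // expf_eq0 gt_eqF ?n_gt0 ?andbF.
Qed.

Lemma avgZ F c : avg (fun f => F f * c) = avg F * c.
Proof. by rewrite /avg -mulr_suml mulrAC. Qed.

(** Redrawing the value at [x] preserves the uniform measure: exchanging [f x] with the fresh value
    [v] is an involution on the pairs [(f, v)]. *)
Lemma avg_resample x F : avg F = avg (fun f => (\sum_v F (upd f x v)) / n).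
Proof.
rewrite avgZ; suff h : \sum_f \sum_v F (upd f x v) = (\sum_f F f) * n.
  by rewrite /avg h mulrAC mulfK // gt_eqF ?n_gt0.
pose swap (p : {ffun V -> W} * W) := (upd p.1 x p.2, p.1 x).
have swapK : involutive swap.
  move=> [f v]; rewrite /swap /=; congr pair; last by rewrite ffunE eqxx.
  by apply/ffunP => y; rewrite !ffunE; case: eqP => // ->.
rewrite pair_bigA /= (reindex_inj (inv_inj swapK)) /=.
rewrite (eq_bigr (fun p => F p.1)) => [|[f v] _ /=]; last first.
  by congr F; apply/ffunP => y; rewrite !ffunE; case: eqP => // ->.
rewrite -(pair_bigA _ (fun f _ => F f)) /= mulr_suml.
by apply: eq_bigr => f _; rewrite sumr_const mulr_natr.
Qed.

Lemma indep_of_sub (D D' : {set V}) F :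
  D' \subset D -> indep_of D F -> indep_of D' F.
Proof. by move=> /subsetP s h f x v /s; apply: h. Qed.

Lemma upd_notin f x v S y : x \notin S -> y \in S -> upd f x v y = f y.
Proof. by move=> xS yS; rewrite ffunE; case: eqP yS xS => // -> ->. Qed.

Lemma upd_imset f x v S : x \notin S -> upd f x v @: S = f @: S.
Proof.
by move=> xS; apply: eq_in_imset => y; apply: upd_notin.
Qed.

Lemma indep_of_imset (D : {set V}) S (phi : {set W} -> R) :
  [disjoint D & S] -> indep_of D (fun f => phi (f @: S)).
Proof. by move=> dis f x v xD; rewrite upd_imset // (disjointFr dis). Qed.

Lemma is_clique_upd f x v S : x \notin S -> is_clique S (upd f x v) = is_clique S f.
Proof.
move=> xS; apply: eq_forallb_in => y yS; apply: eq_forallb_in => z zS.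
by rewrite !(upd_notin _ _ xS).
Qed.

Lemma indep_of_clique (D : {set V}) S :
  [disjoint D & S] -> indep_of D (fun f => (is_clique S f)%:R).
Proof. by move=> dis f x v xD; rewrite is_clique_upd // (disjointFr dis). Qed.

Lemma is_clique_sub S X f : S \subset X -> is_clique X f -> is_clique S f.
Proof.
move=> /subsetP sub /forall_inP h; apply/forall_inP => x /sub /h /forall_inP h'.
by apply/forall_inP => y /sub /h'.
Qed.

(** Separates the condition on the fresh value at [x], so that summing over [v] produces one level
    of [ext]. *)
Lemma is_cliqueU1 f x v S : x \notin S ->
  is_clique (x |: S) (upd f x v) = is_clique S f && (v \in common_nbrs G (f @: S)).
Proof.
move=> xS; rewrite -(is_clique_upd f v xS) inE.
have updS y : y \in S -> upd f x v y = f y by apply: upd_notin.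
have updx : upd f x v x = v by rewrite ffunE eqxx.
apply/idP/andP => [h|[/forall_inP h1 /forall_inP h2]].
  split; first exact: is_clique_sub (subsetUr _ _) h.
  apply/forall_inP => _ /imsetP [y yS ->].
  move/forall_inP/(_ y): h; rewrite !inE yS orbT => /(_ isT) /forall_inP /(_ x).
  rewrite !inE eqxx updx updS // => /(_ isT) /implyP; apply.
  by apply: contraNneq xS => <-.
apply/forall_inP => y; rewrite in_setU1 => /predU1P [->|yS];
  apply/forall_inP => z; rewrite in_setU1 => /predU1P [->|zS].
- by rewrite eqxx.
- by apply/implyP => _; rewrite updx updS // adj_sym h2 // imset_f.
- by apply/implyP => _; rewrite updx updS // h2 // imset_f.
- by move/forall_inP: (h1 y yS); apply.
Qed.

(* Integrating out [X :\: S] one vertex at a time. *)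
Lemma avg_clique S X A : S \subset X -> indep_of (X :\: S) A ->
  avg (fun f => A f * (is_clique X f)%:R) =
  avg (fun f => A f * ((is_clique S f)%:R * extdens R G (#|X| - #|S|) (f @: S))).
Proof.
move=> SX; move cardS : (#|X| - #|S|)%N => k; elim: k S SX cardS => [|k IH] S SX cardS.
  move=> _; move/eqP: cardS; rewrite subn_eq0 => le.
  have /eqP -> : S == X by rewrite eqEcard SX.
  by apply: eq_avg => f; rewrite mulr1.
move=> hA.
have /properP [_ [x xX xS]] : S \proper X.
  by rewrite properEcard SX -subn_gt0 cardS.
have SxX : x |: S \subset X by rewrite subUset sub1set xX.
rewrite (IH (x |: S)) //; last first.
- by apply: indep_of_sub hA; rewrite setDS // subsetUr.
- by rewrite cardsU1 xS subnDA subnAC cardS subn1.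
rewrite (avg_resample x); apply: eq_avg => f.
rewrite -[extdens R G k.+1 _]/((\sum_(v in _) extdens R G k (v |: _)) / _).
rewrite !mulrA; congr (_ / _); rewrite mulr_sumr [RHS]big_mkcond /=.
apply: eq_bigr => v _; rewrite hA ?in_setD ?xS // is_cliqueU1 //.
have -> : upd f x v @: (x |: S) = v |: f @: S.
  by rewrite imsetU1 upd_imset // ffunE eqxx.
case: (is_clique S f); case: (v \in _) => /=;
  by rewrite ?(mulr0, mul0r, mul1r, mulr1) ?mulrA.
Qed.

Lemma avg_is_clique S : avg (fun f => (is_clique S f)%:R) = t #|S|.
Proof.
rewrite (eq_avg (F' := fun f => 1 * (is_clique S f)%:R)) => [|f]; last by rewrite mul1r.
rewrite (@avg_clique set0) ?sub0set // cards0 subn0.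
rewrite (eq_avg (F' := fun f => 1 * t #|S|)) => [|f].
  by rewrite avgZ avg1 mul1r.
rewrite imset0; suff -> : is_clique set0 f by rewrite mul1r.
by apply/forall_inP => x; rewrite inE.
Qed.

(** The values of [f] on [X :\: S], added one vertex at a time, form one of the extensions
    counted. *)
Lemma extdens_gt0 S X f :
  S \subset X -> is_clique X f -> 0 < extdens R G (#|X| - #|S|) (f @: S).
Proof.
move=> SX cX; move cardS : (#|X| - #|S|)%N => k; elim: k S SX cardS => [|k IH] S SX cardS.
  by rewrite ltr01.
have /properP [_ [x xX xS]] : S \proper X.
  by rewrite properEcard SX -subn_gt0 cardS.
have SxX : x |: S \subset X by rewrite subUset sub1set xX.
(* Writing [f] as its own update at [x] makes [is_cliqueU1] applicable. *)
have updfx : upd f x (f x) = f.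
  by apply/ffunP => y; rewrite ffunE; case: eqP => // ->.
have := is_clique_sub SxX cX; rewrite -{1}updfx is_cliqueU1 // => /andP [_ nb].
rewrite /extdens /= divr_gt0 ?n_gt0 // (bigD1 (f x)) //=.
rewrite ltr_pwDl //; last by apply: sumr_ge0 => v _; apply: extdens_ge0.
have := IH _ SxX; rewrite imsetU1; apply.
by rewrite cardsU1 xS subnDA subnAC cardS subn1.
Qed.

End RandomMaps.

(** * Bag sequences, separators and the count of pairs inside bags *)

Section Bags.
Variable V : finType.
Implicit Types (Ps : seq {set V}) (S X : {set V}).

Definition union_bags Ps : {set V} := \bigcup_(X <- Ps) X.

(* The head of the list is the bag added last; [set0] allows a bag to be disjoint
   from the earlier ones. *)
Fixpoint running_intersection Ps : bool :=
  if Ps is X :: Ps' then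
    has (fun Y : {set V} => X :&: union_bags Ps' \subset Y) (set0 :: Ps')
      && running_intersection Ps'
  else true.

Fixpoint separators Ps : seq {set V} :=
  if Ps is X :: Ps' then X :&: union_bags Ps' :: separators Ps' else [::].

Lemma size_separators Ps : size (separators Ps) = size Ps.
Proof. by elim: Ps => //= X Ps ->. Qed.

Lemma separator_sub_bag Ps S :
  S \in separators Ps -> has (fun Y : {set V} => S \subset Y) Ps.
Proof.
elim: Ps => //= X Ps IH; rewrite in_cons => /predU1P [->|/IH ->].
  by rewrite subsetIl.
by rewrite orbT.
Qed.

Lemma union_bags_cons X Ps : union_bags (X :: Ps) = X :|: union_bags Ps.
Proof. exact: big_cons. Qed.

Lemma sub_union_bags S Ps :
  has (fun Y : {set V} => S \subset Y) (set0 :: Ps) -> S \subset union_bags Ps.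
Proof.
elim: Ps => [|X Ps IH] /=; first by rewrite orbF /union_bags big_nil.
rewrite union_bags_cons orbCA => /orP [sX|/IH sPs].
  exact: subset_trans sX (subsetUl _ _).
exact: subset_trans sPs (subsetUr _ _).
Qed.

Definition bag_pairs Ps : {set {set V}} :=
  [set e : {set V} | has (fun X : {set V} => e \subset X) Ps & #|e| == 2].

(** The pairs of a new bag that already occur are exactly those inside its separator: the running
    intersection property puts a nonempty separator into a single earlier bag. *)
Lemma card_bag_pairs N Ps :
    running_intersection Ps -> all (fun X : {set V} => #|X| == N) Ps ->
  #|bag_pairs Ps| = (\sum_(S <- separators Ps) ('C(N, 2) - 'C(#|S|, 2)))%N.
Proof.
elim: Ps => [_ _|X Ps IH].
  by rewrite big_nil; apply/eqP; rewrite cards_eq0; apply/eqP/setP => e; rewrite !inE.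
move=> /= /andP [rip1 rip] /andP [/eqP cX cPs]; rewrite big_cons -IH //.
set T := X :&: union_bags Ps in rip1 *.
pose D (Y : {set V}) := [set e : {set V} | e \subset Y & #|e| == 2].
have -> : bag_pairs (X :: Ps) = D X :|: bag_pairs Ps.
  by apply/setP => e; rewrite !inE /= andb_orl.
have DT : D X :&: bag_pairs Ps = D T.
  apply/setP => e; rewrite !inE; case: (#|e| =P 2) => ce; rewrite ?andbF // !andbT.
  rewrite subsetI; case eX: (e \subset X) => //=; apply/idP/idP => [h|eT].
    by apply: sub_union_bags; rewrite /= h orbT.
  have {}eT : e \subset T by rewrite subsetI eX.
  have := subset_trans eT; case/orP: rip1 => [T0|/hasP [Y YPs TY]] sT.
    by move: (sT _ T0); rewrite subset0 => /eqP e0; rewrite e0 cards0 in ce.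
  by apply/hasP; exists Y; rewrite // sT.
by rewrite cardsU DT !cards_draws cX addnBAC // leq_bin2l // -cX subset_leq_card // subsetIl.
Qed.

End Bags.

(** * The glued random map and its marginals *)

Section HomCount.
Variables (R : realFieldType) (V W : finType) (G : sgraph W) (N : nat).
Hypothesis W0 : (0 < #|W|)%N.
Local Notation t := (clique_dens R G).
Hypothesis tN0 : 0 < t N.
Implicit Types (f : {ffun V -> W}) (F : {ffun V -> W} -> R).
Implicit Types (Ps : seq {set V}) (S X : {set V}).

(** For [f] a clique on [S], this is the probability that [N - #|S|] uniform vertices complete it to
    an [N]-clique. *)
Local Notation kap S f := (extdens R G (N - #|S|) (f @: S)).
Local Notation cliq S f := (is_clique G S f)%:R.

(* The density of the random map obtained by gluing uniformly random [N]-cliques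
   on the bags, conditionally independently given the separators. *)
Definition glue_density Ps f : R :=
  (all (fun X => is_clique G X f) Ps)%:R / \prod_(S <- separators Ps) kap S f.

Lemma glue_density_cons X Ps f :
  glue_density (X :: Ps) f =
  glue_density Ps f / kap (X :&: union_bags Ps) f * cliq X f.
Proof.
rewrite /glue_density /= big_cons invfM.
by case: is_clique => /=; ring.
Qed.

Lemma glue_density_ge0 Ps f : 0 <= glue_density Ps f.
Proof.
by rewrite divr_ge0 ?ler0n // big_seq prodr_ge0 // => S _; apply: extdens_ge0.
Qed.

Lemma indep_of_glue Ps (D : {set V}) :
  [disjoint D & union_bags Ps] -> indep_of D (glue_density Ps).
Proof.
elim: Ps D => [|X Ps IH] D; first by move=> _ f x v _; rewrite /glue_density /= !big_nil.
rewrite union_bags_cons => dis f x v xD; rewrite !glue_density_cons.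
have [dX dPs] : [disjoint D & X] /\ [disjoint D & union_bags Ps].
  by split; apply: disjointWr dis; rewrite (subsetUl, subsetUr).
have dT : [disjoint D & X :&: union_bags Ps].
  by apply: disjointWr dX; rewrite subsetIl.
rewrite (IH D) // (@indep_of_clique R _ _ G D) //.
by rewrite (indep_of_imset (extdens R G (N - _)) dT).
Qed.

(** Guarantees that the quantities divided by are nonzero on the support of [glue_density]. *)
Lemma separator_ok Ps S f :
    all (fun X : {set V} => #|X| == N) Ps ->
    has (fun Y : {set V} => S \subset Y) (set0 :: Ps) ->
    all (fun X => is_clique G X f) Ps ->
  is_clique G S f /\ 0 < kap S f.
Proof.
move=> /allP cPs /hasP [Y]; rewrite in_cons => /predU1P [->|YPs] SY /allP cl.
  have -> : S = set0 by apply/eqP; rewrite -subset0.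
  rewrite cards0 subn0 imset0; split=> //.
  by apply/forall_inP => x; rewrite inE.
rewrite -(eqP (cPs _ YPs)); split; last exact: extdens_gt0 SY (cl _ YPs).
exact: is_clique_sub SY (cl _ YPs).
Qed.

(** On a set [S] inside a bag, the glued map is distributed as the restriction of one uniform
    [N]-clique, whatever bag [S] lies in. The induction removes the last bag, and the factor [kap]
    of its separator cancels in both cases. *)
Lemma glue_marginal Ps S F :
    running_intersection Ps -> all (fun X : {set V} => #|X| == N) Ps ->
    has (fun Y : {set V} => S \subset Y) (set0 :: Ps) ->
    indep_of (union_bags Ps :\: S) F ->
  avg (fun f => glue_density Ps f * F f) =
  avg (fun f => F f * (cliq S f * kap S f)) / t N.
Proof.
elim: Ps S F => [|X Ps IH] S F.
  move=> _ _ /=; rewrite orbF subset0 => /eqP -> _.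
  rewrite -avgZ; apply: eq_avg => f.
  rewrite /glue_density big_nil divr1 /= mul1r cards0 subn0 imset0.
  have -> : is_clique G set0 f by apply/forall_inP => x; rewrite inE.
  by rewrite mul1r mulfK // gt_eqF.
move=> /= /andP [rip1 rip] /andP [/eqP cX cPs] hS hF.
set T := X :&: union_bags Ps in rip1 *.
have TX : T \subset X by rewrite subsetIl.
have dT (D : {set V}) : [disjoint D :\: T & T].
  by rewrite disjoint_subset; apply/subsetP => x; rewrite !inE => /andP [].
have kapT D : indep_of (D :\: T) (fun f => kap T f).
  exact: indep_of_imset (dT D).
have [SX|SPs] : S \subset X \/ has (fun Y : {set V} => S \subset Y) (set0 :: Ps).
- by rewrite /= orbCA in hS; case/orP: hS; [left|right].
(* When [S] lies in the new bag, absorb that bag's factors into the test function and take the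
   earlier marginal on the separator [T]; both sides become averages over cliques on [X]. *)
- rewrite -cX -(@avg_clique R V W G W0 S X F SX); last first.
    by apply: indep_of_sub hF; rewrite setSD // union_bags_cons subsetUl.
  pose F' f := (kap T f)^-1 * cliq X f * F f.
  transitivity (avg (fun f => glue_density Ps f * F' f)).
    by apply: eq_avg => f; rewrite glue_density_cons !mulrA.
  rewrite (IH T) //; last first.
    have dX : [disjoint union_bags Ps :\: T & X].
      rewrite disjoint_subset; apply/subsetP => x; rewrite !inE => /andP [].
      by rewrite andbC => h xPs; rewrite xPs in h.
    move=> f x v xD; rewrite /F'; have /= -> := kapT _ f x v xD.
    have /= -> := @indep_of_clique R _ _ G _ _ dX f x v xD.
    rewrite hF // in_setD union_bags_cons in_setU.
    have /negbT xX := disjointFr dX xD; case/setDP: xD => -> _.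
    by rewrite orbT andbT (contra (subsetP SX x)).
  congr (_ / _); last by rewrite cX.
  apply: eq_avg => f; rewrite /F'.
  case cl: (is_clique G X f); last by rewrite !(mulr0, mul0r).
  rewrite (is_clique_sub TX cl) mul1r mulr1 mulrAC mulVf ?mul1r ?mulr1 //.
  by rewrite -cX gt_eqF // extdens_gt0.
(* When [S] lies in an earlier bag, integrating out [X :\: T] yields [kap T f], which cancels the
   denominator of the new bag. *)
rewrite -IH //; last first.
  by apply: indep_of_sub hF; rewrite setSD // union_bags_cons subsetUr.
pose A f := glue_density Ps f / kap T f * F f.
transitivity (avg (fun f => A f * cliq X f)).
  by apply: eq_avg => f; rewrite glue_density_cons mulrAC.
rewrite (@avg_clique R V W G W0 T X A TX) ?cX; last first.
  have dPs : [disjoint X :\: T & union_bags Ps].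
    rewrite disjoint_subset; apply/subsetP => x; rewrite !inE => /andP [].
    by move=> h xX; rewrite xX in h.
  move=> f x v xD; rewrite /A; have /= -> := kapT _ f x v xD.
  rewrite (indep_of_glue dPs) // hF // in_setD union_bags_cons in_setU.
  have /negbT xPs := disjointFr dPs xD; case/setDP: xD => -> _.
  by rewrite andbT (contra (subsetP (sub_union_bags SPs) x)).
apply: eq_avg => f; rewrite /A.
case al: (all (fun X => is_clique G X f) Ps); last first.
  by rewrite /glue_density al !mul0r.
have [-> k0] := separator_ok cPs rip1 al.
by rewrite mul1r; field; rewrite gt_eqF.
Qed.

(** Total mass is the marginal on the empty set. *)
Lemma avg_glue_density Ps :
    running_intersection Ps -> all (fun X : {set V} => #|X| == N) Ps ->
  avg (glue_density Ps) = 1.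
Proof.
move=> rip cPs; rewrite (eq_avg (F' := fun f => glue_density Ps f * 1)) => [|f].
  rewrite (@glue_marginal _ set0) //= ?sub0set //.
  rewrite (eq_avg (F' := fun f => 1 * t N)) => [|f].
    by rewrite avgZ avg1 // mul1r divff // gt_eqF.
  have -> : is_clique G set0 f by apply/forall_inP => x; rewrite inE.
  by rewrite imset0 cards0 subn0 mul1r.
by rewrite mulr1.
Qed.

(** The marginal density on [S] has a factor [kap S f] that cancels the inverse. Only an inequality
    results, since where [kap S f = 0] its inverse is 0 as well. *)
Lemma avg_glue_density_sep Ps S :
    running_intersection Ps -> all (fun X : {set V} => #|X| == N) Ps ->
    S \in separators Ps ->
  avg (fun f => glue_density Ps f / kap S f) <= t #|S| / t N.
Proof.
move=> rip cPs sep; rewrite (@glue_marginal Ps S) //; last first.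
- have dS : [disjoint union_bags Ps :\: S & S].
    by rewrite disjoint_subset; apply/subsetP => x; rewrite !inE => /andP [].
  exact: (indep_of_imset (fun B => (extdens R G (N - #|S|) B)^-1) dS).
- by rewrite /= separator_sub_bag // orbT.
rewrite -(@avg_is_clique _ V _ G W0) ler_wpM2r ?invr_ge0 ?(ltW tN0) //.
apply: avg_le => f; have [k0|k0] := eqVneq (kap S f) 0.
  by rewrite k0 invr0 mul0r ler0n.
by rewrite mulrCA mulVf // mulr1.
Qed.

(* Hoelder's inequality for the [glue_density] expectation of the product of
   [prod_S kap_S] with the functions [1 / kap_S], which is identically 1 on the
   support. *)
Lemma clique_dens_bags Ps :
    running_intersection Ps -> all (fun X : {set V} => #|X| == N) Ps ->
  t N ^+ size Ps <= avg (fun f => (all (fun X => is_clique G X f) Ps)%:R) *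
                    \prod_(S <- separators Ps) t #|S|.
Proof.
move=> rip cPs; pose c : R := #|W|%:R ^+ #|V|.
have c0 : 0 < c by rewrite exprn_gt0 // ltr0n.
pose g (o : option {set V}) f : R :=
  if o is Some Q then (kap Q f)^-1 else \prod_(S <- separators Ps) kap S f.
have kap0 (S : {set V}) f : 0 <= kap S f by apply: extdens_ge0.
have avgE F : \sum_f glue_density Ps f / c * F f = avg (fun f => glue_density Ps f * F f).
  by rewrite /avg mulr_suml; apply: eq_bigr => f _; rewrite mulrAC.
have := @holder_prod_ge1 _ _ _ (fun f => glue_density Ps f / c) g
  (None :: map Some (separators Ps)).
have -> : \sum_f glue_density Ps f / c = 1.
  by rewrite -(avg_glue_density rip cPs) /avg mulr_suml.
have h1 f : 0 <= glue_density Ps f / c by rewrite divr_ge0 ?glue_density_ge0 ?ltW.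
have h2 o f : 0 <= g o f.
  by case: o => [S|] /=; rewrite ?invr_ge0 //; apply: prodr_ge0.
move=> /(_ h1 erefl h2); rewrite !big_cons !big_map avgE => H.
have {}H : 1 <= avg (fun f => glue_density Ps f * g None f) *
    \prod_(S <- separators Ps) avg (fun f => glue_density Ps f / kap S f).
  rewrite (eq_bigr (fun S => \sum_f glue_density Ps f / c * g (Some S) f)).
    (* A zero product would force [glue_density] to be 0, the inverse of 0 being 0. *)
    apply: H => f gl0; rewrite big_cons big_map /= prodfV divff //.
    by apply: contra_neq gl0 => k0; rewrite /glue_density k0 invr0 mulr0 mul0r.
  by move=> S _; rewrite avgE.
have tN i : 0 < t N ^+ i by rewrite exprn_gt0.
rewrite -[leLHS]mul1r -ler_pdivlMr // -mulrA; apply: le_trans H _.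
have sepE : \prod_(S <- separators Ps) (t #|S| / t N) =
    \prod_(S <- separators Ps) t #|S| / t N ^+ size Ps.
  by rewrite big_split /= prodfV big_const_seq count_predT size_separators
    -Monoid.iteropE -[iterop _ _ _ _]/(_ ^+ _).
rewrite -sepE; apply: ler_pM.
- apply: avg_ge0 => f; rewrite mulr_ge0 ?glue_density_ge0 //; exact: (h2 None).
- rewrite big_seq prodr_ge0 // => S _; apply: avg_ge0 => f.
  by rewrite divr_ge0 ?glue_density_ge0.
- apply: avg_le => f; rewrite /glue_density /=.
  set P := \prod_(S <- _) _; have [->|P0] := eqVneq P 0.
    by rewrite mulr0 ler0n.
  by rewrite divfK.
rewrite big_seq [leRHS]big_seq; apply: ler_prod => S sep.
rewrite avg_glue_density_sep // andbT; apply: avg_ge0 => f.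
by rewrite divr_ge0 ?glue_density_ge0.
Qed.

End HomCount.

(** * Ordering the bags of a tree decomposition *)

Section BagOrdering.
Variables (V : finType) (H : sgraph V) (F : {set {set V}}).
Variable T : sgraph {X : {set V} | X \in F}.
Hypothesis decT : tree_decomposition H T.
Local Notation node := {X : {set V} | X \in F}.

Lemma path_leaves (L : seq node) Y p :
    path T Y p -> Y \in L -> last Y p \notin L ->
  exists a b, [/\ a \in L, b \notin L & T a b].
Proof.
elim: p Y => [|Z p IH] Y /=; first by move=> _ ->.
move=> /andP [YZ Zp] YL lastL; case ZL: (Z \in L); first exact: IH Zp ZL lastL.
by exists Y, Z; rewrite YL ZL.
Qed.

Lemma mem_union_bags (Ps : seq {set V}) x :
  reflect (exists2 X, X \in Ps & x \in X) (x \in union_bags Ps).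
Proof.
apply: (iffP idP) => [|[X XPs xX]]; rewrite /union_bags.
  elim: Ps => [|X Ps IH]; first by rewrite big_nil inE.
  rewrite big_cons in_setU => /orP [xX|/IH [Y YPs xY]].
    by exists X; rewrite ?mem_head.
  by exists Y; rewrite // in_cons YPs orbT.
by rewrite (big_rem X) //= in_setU xX.
Qed.

(* Each new bag [X] is adjacent to an earlier bag [Y], and the simple path from
   [X] to any earlier bag can be taken through [Y] because the earlier bags are
   connected among themselves. *)
Lemma bag_ordering :
  exists2 Ps : seq {set V}, running_intersection Ps & Ps =i F.
Proof.
have [[node0 connT _] _ _ pathT] := decT.
suff [L [uL szL _ ripL]] : exists L : seq node, [/\ uniq L, size L = #|{: node}|,
    forall Y Z, Y \in L -> Z \in L ->
      exists p, [/\ path T Y p, last Y p = Z & {subset p <= L}]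
    & running_intersection (map val L)].
  have inL Z : Z \in L.
    have sub : {subset L <= enum {: node}} by move=> ? _; rewrite mem_enum.
    have [|_ ->] := uniq_min_size uL sub; first by rewrite szL cardE.
    by rewrite mem_enum.
  exists (map val L) => // X; apply/mapP/idP => [[Z _ ->]|XF]; first exact: valP.
  by exists (exist _ X XF).
(* Grow the list one node at a time, for every size [k] up to the number of nodes. *)
move: (leqnn #|{: node}|); move: {-2}#|{: node}| => k.
elim: k => [|k IH] kle; first by exists [::].
have [L [uL szL conL ripL]] := IH (ltnW kle).
have [X0 X0L] : exists X0, X0 \notin L.
  case: (pickP (fun X => X \notin L)) => [X XL|all_in]; first by exists X.
  have : (#|{: node}| <= size L)%N.
    rewrite -(card_uniqP uL); apply: subset_leq_card; apply/subsetP => Z _.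
    by have := all_in Z; case: (Z \in L).
  by rewrite szL leqNgt kle.
case: L => [|Y0 L'] in uL szL conL ripL X0L *.
  exists [:: X0]; split=> //=; first by rewrite -szL.
    by move=> Y Z; rewrite !inE => /eqP -> /eqP ->; exists [::].
  by rewrite /union_bags big_nil setI0 subxx.
set L := Y0 :: L' in uL szL conL ripL X0L *.
have /connectP [p Yp X0p] := connT Y0 X0.
have [Y [X [YL XL YX]]] : exists a b, [/\ a \in L, b \notin L & T a b].
  by apply: (path_leaves Yp); rewrite -?X0p ?mem_head.
exists (X :: L); split.
- by rewrite cons_uniq XL.
- by rewrite -szL.
- move=> A B; rewrite 2!in_cons => /predU1P [->|AL] /predU1P [->|BL].
  + by exists [::].
  + have [q [Yq lq sq]] := conL Y B YL BL; exists (Y :: q).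
    split=> //=; first by rewrite adj_sym YX.
    by move=> Z; rewrite 2!in_cons => /predU1P [->|/sq ->]; rewrite ?YL orbT.
  + have [q [Aq lq sq]] := conL A Y AL YL; exists (rcons q X).
    rewrite rcons_path Aq lq YX last_rcons; split=> // Z.
    by rewrite mem_rcons 2!in_cons => /predU1P [->|/sq ->]; rewrite ?eqxx ?orbT.
  + have [q [Aq lq sq]] := conL A B AL BL; exists q; split=> // Z /sq ZL.
    by rewrite in_cons ZL orbT.
apply/andP; split=> //; apply/hasP; exists (val Y).
  by rewrite in_cons; apply/orP; right; apply: map_f YL.
apply/subsetP => x; rewrite inE => /andP [xX].
move=> /(mem_union_bags (map val L)) [_ /mapP [Z ZL ->] xZ].
have [q [Yq lq sq]] := conL Y Z YL ZL.
case/shortenP: Yq lq => q' Yq' uq' sq' lq'.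
suff /pathT/subsetP sub : on_path T X Z Y by apply: sub; rewrite in_setI xX.
exists (Y :: q'); split; last by rewrite 2!in_cons eqxx orbT.
- by rewrite /= adj_sym YX.
- exact: lq'.
(* The shortened walk stays among the earlier nodes, hence avoids [X]. *)
rewrite cons_uniq uq' andbT; apply: contra XL.
by rewrite in_cons => /predU1P [->|/sq' /sq].
Qed.

End BagOrdering.

(** * Complete bags, edges and homomorphisms *)

Lemma isomorphic_complete (V : finType) (H : sgraph V) (X : {set V}) (k : nat) :
    isomorphic (induced H X) (complete k) ->
  #|X| = k /\ {in X &, forall x y, x != y -> H x y}.
Proof.
case=> f bij_f fH; split=> [|x y xX yX xy].
  by rewrite -[RHS]card_ord -(bij_eq_card bij_f) card_sig.
have := fH (exist _ x xX) (exist _ y yX); rewrite /= /induced_rel /= => <-.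
by rewrite /complete_rel (bij_eq bij_f) -val_eqE.
Qed.

Section CompleteBags.
Variables (V : finType) (H : sgraph V) (Ps : seq {set V}).
Hypothesis edge_in_bag :
  forall e, e \in edges H -> has (fun X : {set V} => e \subset X) Ps.
Hypothesis bag_complete :
  forall X, X \in Ps -> {in X &, forall x y, x != y -> H x y}.

Lemma edges_bag_pairs : edges H = bag_pairs Ps.
Proof.
apply/setP => e; rewrite inE; apply/idP/andP => [eH|[/hasP [X XPs eX] /cards2P]].
  split; first exact: edge_in_bag.
  case/imset2P: eH => x y _; rewrite inE => /andP [_ xy] ->.
  by rewrite cards2; case: (x =P y) xy => // ->; rewrite adj_irr.
move=> [x [y [xy de]]]; subst e; apply/imset2P; exists x y => //.
rewrite inE; apply: (bag_complete XPs) => //; apply: (subsetP eX).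
  by rewrite !inE eqxx.
by rewrite !inE eqxx orbT.
Qed.

(** Every edge lies in a bag, so a map that is a clique on each bag is a homomorphism. *)
Lemma avg_bags_le_hom_density (R : realType) (W : finType) (G : sgraph W) :
  avg (fun f : {ffun V -> W} => (all (fun X => is_clique G X f) Ps)%:R) <=
  hom_density R H G.
Proof.
rewrite /hom_density -sum1_card natr_sum [X in _ <= X / _]big_mkcond /=.
rewrite ler_wpM2r ?invr_ge0 ?exprn_ge0 ?ler0n //; apply: ler_sum => f _.
case: allP => [cl|_]; last by case: ifP.
suff -> : f \in homs H G by [].
rewrite inE; apply/forallP => x; apply/forallP => y; apply/implyP => xy.
have /edge_in_bag /hasP [X XPs /subsetP sX] : [set x; y] \in edges H.
  by apply/imset2P; exists x y; rewrite ?inE.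
have xX : x \in X by apply: sX; rewrite !inE eqxx.
have yX : y \in X by apply: sX; rewrite !inE eqxx orbT.
have /forall_inP /(_ x xX) /forall_inP /(_ y yX) /implyP := cl X XPs; apply.
by apply: contraTneq xy => ->; rewrite adj_irr.
Qed.

End CompleteBags.

(** * The final lower bound and the choice of constants *)

Lemma bernoulli_sub (R : realDomainType) (x : R) (k : nat) :
  0 <= x -> x <= 1 -> 1 - k%:R * x <= (1 - x) ^+ k.
Proof.
move=> x0 x1; elim: k => [|k IH]; first by rewrite mul0r subr0.
rewrite exprS; apply: le_trans (ler_wpM2l _ IH); last by rewrite subr_ge0.
have : 0 <= k%:R * (x * x) by rewrite !mulr_ge0.
by rewrite -natr1; lra.
Qed.

Section Counting.
Variables (R : realType) (V W : finType) (G : sgraph W).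
Variables (rho d theta : R) (r : nat).
Hypotheses (rho0 : 0 <= rho) (W0 : (0 < #|W|)%N) (dG : dense rho d G).
Hypotheses (th0 : 0 < theta) (th1 : theta <= 1) (d0 : 0 < d) (d1 : d <= 1).
Hypothesis rho_small : rho ^+ 2 <= (1 - theta) * (theta * d) ^+ r.*2.
Local Notation t := (clique_dens R G).

Lemma clique_dens_gt0 k : (k <= r.+1)%N -> 0 < t k.
Proof.
have ratio := @clique_dens_ratio _ _ _ _ _ (ltW d0) rho0 W0 dG theta r.
rewrite leq_eqVlt => /predU1P [->|kr]; last by case: (ratio k).
have [//|t0] := ratio r th0 th1 d0 d1 rho_small.
by apply: lt_le_trans; rewrite mulr_gt0 ?exprn_gt0 ?mulr_gt0.
Qed.

(** Divide [clique_dens_bags] by the separator densities: each bag contributes a ratio bounded by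
    [clique_dens_ratio_le], and [card_bag_pairs] adds up the exponents. *)
Lemma bags_density_ge (Ps : seq {set V}) :
    running_intersection Ps -> all (fun X : {set V} => #|X| == r.+1) Ps ->
  (theta * d) ^+ #|bag_pairs Ps| <=
  avg (fun f : {ffun V -> W} => (all (fun X => is_clique G X f) Ps)%:R).
Proof.
move=> rip cPs.
have sepN S : S \in separators Ps -> (#|S| <= r.+1)%N.
  move=> /separator_sub_bag /hasP [X XPs SX].
  by rewrite -(eqP (allP cPs X XPs)) subset_leq_card.
have tN0 := clique_dens_gt0 (leqnn r.+1).
have prod0 : 0 < \prod_(S <- separators Ps) t #|S|.
  by rewrite big_seq prodr_gt0 // => S /sepN; apply: clique_dens_gt0.
rewrite -(ler_pM2r prod0); apply: le_trans (clique_dens_bags W0 tN0 rip cPs).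
rewrite (card_bag_pairs rip cPs) -prodrXr -big_split /=.
rewrite -size_separators.
rewrite (_ : t r.+1 ^+ _ = \prod_(S <- separators Ps) t r.+1); last first.
  by rewrite big_const_seq count_predT -Monoid.iteropE.
rewrite big_seq [leRHS]big_seq; apply: ler_prod => S /sepN Sr.
rewrite mulr_ge0 ?exprn_ge0 ?mulr_ge0 ?(ltW th0) ?(ltW d0) ?extdens_ge0 //=.
exact: (clique_dens_ratio_le (ltW d0) rho0 W0 dG).
Qed.

End Counting.

Theorem theorem1p3 (R : realType) (r : nat) (hr : (0 < r)%N)
    (V : finType) (H : sgraph V) (hH : r_tree r H) (eta : R) (heta : 0 < eta) :
  exists (rho : R) (n0 : nat), 0 < rho /\
    forall (d : R) (W : finType) (G : sgraph W),
      0 <= d -> dense rho d G -> (n0 <= #|W|)%N ->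
      d ^+ #|edges H| - eta <= hom_density R H G.
Proof.
have [F [T [decT isoF]]] := hH.
have [Ps rip PsF] := bag_ordering decT.
have [[node0 _ _] _ edgeF _] := decT.
have edge_in e : e \in edges H -> has (fun X : {set V} => e \subset X) Ps.
  by move=> /edgeF [X XF eX]; apply/hasP; exists X; rewrite ?PsF.
have bagF X : X \in Ps -> #|X| = r.+1 /\ {in X &, forall x y, x != y -> H x y}.
  by rewrite PsF => /isoF; apply: isomorphic_complete.
have cPs : all (fun X : {set V} => #|X| == r.+1) Ps.
  by apply/allP => X /bagF [->].
have complete X XPs := (bagF X XPs).2.
have edgesE := edges_bag_pairs edge_in complete.
(* A bag has [r.+1 >= 2] vertices and so contains an edge; this later gives [d ^+ e <= d]. *)
have e_gt0 : (0 < #|edges H|)%N.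
  have /card_gt0P [[X XF] _] := node0.
  have XPs : X \in Ps by rewrite PsF.
  have [/eqP cX _] := bagF X XPs.
  have /card_gt0P [e] : (0 < #|[set e : {set V} | e \subset X & #|e| == 2]|)%N.
    by rewrite cards_draws (eqP cX) bin_gt0.
  rewrite inE => /andP [eX ce]; rewrite edgesE; apply/card_gt0P; exists e.
  by rewrite inE ce andbT; apply/hasP; exists X.
set e := #|edges H| in e_gt0 *.
have [eta1 [eta1_gt0 eta1_le1 eta1_le]] :
    exists eta1 : R, [/\ 0 < eta1, eta1 <= 1 & eta1 <= eta].
  by exists (Num.min eta 1); rewrite lt_min heta ltr01 !ge_min !lexx orbT.
(* The term [x * e%:R] is the Bernoulli loss in [(1 - x) ^+ e]; the term [2 * x] forces [x < 1]. *)
have [x x_gt0 xE] : exists2 x : R, 0 < x & x * e%:R + 2 * x = eta1.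
  exists (eta1 / e.+2%:R); first by rewrite divr_gt0 ?ltr0n.
  by rewrite [2 * _]mulrC -mulrDr -natrD addn2 divfK ?pnatr_eq0.
pose theta := 1 - x.
have x_lt1 : x < 1.
  have : 0 <= x * e%:R by rewrite mulr_ge0 // ltW.
  lra.
have th0 : 0 < theta by rewrite subr_gt0.
have th1 : theta <= 1 by rewrite gerBl ltW.
have base_le1 : theta * eta1 <= 1 by rewrite mulr_ile1 // ltW.
(* Here [eta1] stands in for the unknown [d]: since [x = 1 - theta] is at most 1, [rho_small]
   follows once [eta1 <= d]. *)
pose rho := x * (theta * eta1) ^+ r.
have rho0 : 0 < rho by rewrite mulr_gt0 // exprn_gt0 // mulr_gt0.
have rho1 : rho <= 1.
  by rewrite /rho mulr_ile1 ?exprn_ile1 ?exprn_ge0 ?mulr_ge0 ?(ltW x_gt0)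
     ?(ltW x_lt1) ?(ltW th0) ?(ltW eta1_gt0).
exists rho, 1; split=> // d W G d0 dG W0.
(* If [d ^+ e <= eta] the bound is trivial; otherwise [d >= d ^+ e > eta >= eta1], a lower bound on
   [d] independent of [G]. *)
have [small|big] := leP (d ^+ e) eta.
  by apply: le_trans (_ : 0 <= _); rewrite ?subr_le0 // divr_ge0 ?exprn_ge0.
have d1 : d <= 1 := dense_le1 W0 dG rho1.
have de_le1 : d ^+ e <= 1 by rewrite exprn_ile1.
have d_gt : eta1 <= d.
  apply: le_trans eta1_le (le_trans (ltW big) _).
  by rewrite -[leRHS]expr1 ler_wiXn2l.
have rho_small : rho ^+ 2 <= (1 - theta) * (theta * d) ^+ r.*2.
  rewrite /rho exprMn -exprM muln2 subKr; apply: ler_pM.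
  - by rewrite exprn_ge0 // ltW.
  - by rewrite exprn_ge0 // mulr_ge0 // ltW.
  - by rewrite expr2 ler_piMl // ltW.
  - rewrite lerXn2r ?nnegrE ?mulr_ge0 ?(ltW th0) ?(ltW eta1_gt0) //.
    by rewrite ler_wpM2l // ltW.
have d_gt0 : 0 < d by apply: lt_le_trans d_gt.
apply: le_trans (avg_bags_le_hom_density edge_in R G).
apply: le_trans (bags_density_ge (ltW rho0) W0 dG th0 th1 d_gt0 d1 rho_small rip cPs).
rewrite -edgesE -/e exprMn.
have bern := bernoulli_sub e (ltW x_gt0) (ltW x_lt1); rewrite -/theta in bern.
have thle : theta ^+ e <= 1 by rewrite exprn_ile1 // ltW.
(* This gives [p * q >= p + q - 1] for the two powers [p] and [q], leaving only linear arithmetic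
   with Bernoulli's bound on [p]. *)
have h : 0 <= (1 - theta ^+ e) * (1 - d ^+ e) by rewrite mulr_ge0 // subr_ge0.
move: (theta ^+ e) (d ^+ e) (e%:R : R) bern h xE => p q m bern h xE.
clear -bern h xE x_gt0 eta1_le; lra.
Qed.
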